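(* Let $\mathbf{Q}(t)=(Q_1(t),\ldots,Q_K(t))$, $t\in\{0,1,2,\ldots\}$, be a stochastic vector process with real-valued components and $p(t)$ a real-valued stochastic process on the same probability space; let $\mathcal{H}(0)=\{\mathbf{Q}(0)\}$ and $\mathcal{H}(t)=\{\mathbf{Q}(0),\ldots,\mathbf{Q}(t),p(0),\ldots,p(t-1)\}$ for $t>0$. Let $L(\mathbf{Q})=\frac{1}{2}\sum_{k=1}^Kw_kQ_k^2$ with constants $w_k>0$, $\|\mathbf{Q}\|=\sqrt{L(\mathbf{Q})}$, $\Delta(\mathcal{H}(t))=\mathbb{E}[L(\mathbf{Q}(t+1))-L(\mathbf{Q}(t))\mid\mathcal{H}(t)]$, and $d_k(t)=Q_k(t+1)-Q_k(t)$. Suppose there is a finite constant $D$ with $\mathbb{E}[d_k(t)^4\mid\mathbf{Q}(t)]\leq D$ for all $t$, all possible $\mathbf{Q}(t)$ and all $k$; that $\mathbb{E}[\|\mathbf{Q}(0)\|^4]<\infty$; and that there are constants $\epsilon>0$ and $\tilde{B}>0$ such that for all $t$ and all possible $\mathcal{H}(t)$, $$\Delta(\mathcal{H}(t))\leq\tilde{B}-\epsilon\sum_{k=1}^K|Q_k(t)|.$$ Then: (a) There are constants $c>0$ and $a>0$ such that whenever $\|\mathbf{Q}(t)\|\geq a$, $\mathbb{E}[\|\mathbf{Q}(t+1)\|\mid\mathbf{Q}(t)]\leq\|\mathbf{Q}(t)\|-c$. (b) There is a finite constant $b>0$ such that for all $M\in\{1,2,\ldots\}$, $\frac{1}{M}\sum_{t=0}^{M-1}\mathbb{E}[\|\mathbf{Q}(t)\|^3]\leq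 b$. (c) For all $k\in\{1,\ldots,K\}$, $\sum_{t=1}^\infty\mathbb{E}[Q_k(t)^2]/t^2<\infty$. (d) For all $k\in\{1,\ldots,K\}$, $\lim_{t\to\infty}Q_k(t)/t=0$ with probability 1. (e) $\limsup_{t\to\infty}\frac{1}{t}\sum_{\tau=0}^{t-1}\sum_{k=1}^K|Q_k(\tau)|\leq\tilde{B}/\epsilon$ with probability 1.
   Context: Time is slotted. ''For all possible $\mathcal{H}(t)$'' (resp. $\mathbf{Q}(t)$) means for every realization (almost surely). *)

(* Defs.v *)
From HB Require Import structures.
From mathcomp Require Import all_boot all_order all_algebra.
From mathcomp Require Import all_classical all_reals all_analysis.
Set Implicit Arguments. Unset Strict Implicit. Unset Printing Implicit Defensive.
Import Order.TTheory GRing.Theory Num.Theory.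
Import numFieldNormedType.Exports.
Local Open Scope classical_set_scope.
Local Open Scope ring_scope.

Section defs.
Context {d : measure_display} {T : measurableType d} {R : realType}.

Definition gen_sigma (fs : set (T -> R)) : set (set T) :=
  smallest (sigma_algebra [set: T])
    [set f @^-1` B | f in fs & B in [set B : set R | measurable B]]%classic.

Definition cond_exp_version (P : probability T R) (G : set (set T))
    (X Y : T -> R) : Prop :=
  [/\ P.-integrable [set: T] (EFin \o X),
      (forall B : set R, measurable B -> G (Y @^-1` B)),
      P.-integrable [set: T] (EFin \o Y)
    & forall A, G A ->
        (\int[P]_(x in A) (X x)%:E = \int[P]_(x in A) (Y x)%:E)%E].

End defs.

Definition lyap {R : realType} {K : nat} (w : 'I_K -> R) (q : 'I_K -> R) : R :=
  2^-1 * \sum_(k < K) w k * q k ^+ 2.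

Definition qnorm {R : realType} {K : nat} (w : 'I_K -> R) (q : 'I_K -> R) : R :=
  Num.sqrt (lyap w q).

(* Main.v *)
(** Write L(t) = L(Q(t)), N(t) = sqrt L(t) and S(t) = sum_k |Q_k(t)|.

    Concavity of the square root gives N(t+1) - N(t) <= (L(t+1) - L(t)) / (2 N(t)), so
    the drift condition on L becomes a constant negative drift of N away from 0: this
    is (a).  The drift condition multiplied by L(t), with
    E[(L(t+1) - L(t))^2] = O(1 + E[L(t)]), bounds the drift of L^2 by c - r E[N(t)^3];
    telescoping gives (b).  Abel summation turns the linear growth of
    sum_(t<n) E[Q_k(t)^2] into (c), and (d) holds because a.s. the series
    sum_t Q_k(t)^2 / t^2 converges.

    For (e), X(n) = sum_(t<n) (L(t+1) - L(t) - Bt + eps S(t)) is a supermartingale, and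
    the second moment of its positive part grows at most linearly, so X^+(n)/n tends to
    0 a.s. along the squares.  As L >= 0, this bounds the averages of S along the
    squares; the partial sums of S being monotone, it bounds all averages.  No maximal
    inequality or martingale convergence theorem is needed. *)

Require Import Defs.
From HB Require Import structures.
From mathcomp Require Import all_boot all_order all_algebra.
From mathcomp Require Import all_classical all_reals all_analysis.
From mathcomp Require Import measurable_realfun.
From mathcomp Require Import ring lra.
Set Implicit Arguments. Unset Strict Implicit. Unset Printing Implicit Defensive.
Import Order.TTheory GRing.Theory Num.Theory.
Import numFieldNormedType.Exports.
Local Open Scope classical_set_scope.
Local Open Scope ring_scope.

(** * Integrable and square-integrable real functions on a probability space *)

Section integrable_real.
Context {d : measure_display} {T : measurableType d} {R : realType}.
Variable P : probability T R.
Implicit Types f g : T -> R.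

Notation "'int' f" := (P.-integrable [set: T] (EFin \o f)) (at level 10, f at level 9).

Lemma integrable_measurable f : int f -> measurable_fun [set: T] f.
Proof. by move=> /integrableP[/measurable_EFinP]. Qed.

Lemma le_integrable_fin f g : measurable_fun [set: T] f ->
  (forall x, `|f x| <= g x) -> int g -> int f.
Proof.
move=> mf fg; apply: le_integrable => //; first exact/measurable_EFinP.
by move=> x _ /=; rewrite lee_fin (le_trans (fg x))// ler_norm.
Qed.

Lemma integrable_cst_fin (c : R) : int (fun=> c).
Proof. exact: finite_measure_integrable_cst. Qed.

Lemma integrableD_fin f g : int f -> int g -> int (fun x => f x + g x).
Proof.
by move=> intf intg; apply: eq_integrable (integrableD measurableT intf intg).
Qed.

Lemma integrableZl_fin (c : R) f : int f -> int (fun x => c * f x).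
Proof.
by move=> intf; apply: eq_integrable (integrableZl measurableT c intf).
Qed.

Lemma integrableB_fin f g : int f -> int g -> int (fun x => f x - g x).
Proof.
by move=> intf intg; apply: eq_integrable (integrableB measurableT intf intg).
Qed.

Lemma integrable_sum_fin (I : Type) (s : seq I) (h : I -> T -> R) :
  (forall i, int (h i)) -> int (fun x => \sum_(i <- s) h i x).
Proof.
move=> inth; have := @integrable_sum _ _ _ P _ measurableT I s predT
  (fun i => EFin \o h i) (fun i _ => inth i).
by apply: eq_integrable => // x _ /=; rewrite sumEFin.
Qed.

Lemma Rintegral_sum (I : Type) (s : seq I) (h : I -> T -> R) :
  (forall i, int (h i)) ->
  \int[P]_x (\sum_(i <- s) h i x) = \sum_(i <- s) \int[P]_x h i x.
Proof.
move=> inth; elim: s => [|i s IH].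
  under eq_Rintegral do rewrite big_nil.
  by rewrite Rintegral_cst// mul0r big_nil.
under eq_Rintegral do rewrite big_cons.
by rewrite RintegralD// ?IH ?big_cons//; exact: integrable_sum_fin.
Qed.

Lemma Rintegral_fin f : int f -> (\int[P]_x (f x)%:E)%E = (\int[P]_x f x)%:E.
Proof. by move=> intf; rewrite /Rintegral fineK// integrable_fin_num. Qed.

Lemma Rintegral_cstT (c : R) : \int[P]_x c = c.
Proof. by rewrite Rintegral_cst// (congr1 fine (probability_setT P)) mulr1. Qed.

Lemma Rintegral_indicM (A : set T) f : measurable A -> int f ->
  \int[P]_(x in A) f x = \int[P]_x (\1_A x * f x).
Proof.
move=> mA intf; rewrite Rintegral_mkcond; apply: eq_Rintegral => x _.
by rewrite patchE indicE; case: ifPn => _ /=; rewrite ?mul1r ?mul0r.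
Qed.

Lemma integrable_indicM (A : set T) f : measurable A -> int f ->
  int (fun x => \1_A x * f x).
Proof.
move=> mA intf; apply: (@le_integrable_fin _ (fun x => `|f x|)).
- by apply: measurable_funM; [exact: measurable_indic|exact: integrable_measurable].
- move=> x; rewrite indicE; case: (x \in A); rewrite ?mul1r// mul0r normr0//.
- exact: integrable_norm.
Qed.

(** Measurability of [f] is recorded separately, since integrability of the square only yields
    measurability of the square. *)
Definition square_integrable f :=
  measurable_fun [set: T] f /\ int (fun x => f x ^+ 2).

Lemma square_integrable_cst (c : R) : square_integrable (fun=> c).
Proof. by split => //; exact: integrable_cst_fin. Qed.

Lemma square_integrableM f g : square_integrable f -> square_integrable g ->
  int (fun x => f x * g x).
Proof.
move=> [mf f2] [mg g2].
apply: (@le_integrable_fin _ (fun x => f x ^+ 2 + g x ^+ 2)).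
- exact: measurable_funM.
- move=> x; rewrite normrM -(real_normK (num_real (f x))).
  rewrite -(real_normK (num_real (g x))).
  set a := `|f x|; set b := `|g x|.
  have : 0 <= (a - b) ^+ 2 by exact: sqr_ge0.
  have := sqr_ge0 a; have := sqr_ge0 b; nra.
- exact: integrableD_fin.
Qed.

Lemma square_integrable_integrable f : square_integrable f -> int f.
Proof.
move=> sf; have := square_integrableM sf (square_integrable_cst 1).
by apply: eq_integrable => // x _ /=; rewrite mulr1.
Qed.

Lemma square_integrable_le f g : measurable_fun [set: T] f ->
  (forall x, `|f x| <= `|g x|) -> square_integrable g -> square_integrable f.
Proof.
move=> mf fg [mg g2]; split => //; apply: le_integrable_fin g2.
  exact: measurable_funX.
by move=> x; rewrite normrX -[leRHS]real_normK ?num_real// lerXn2r// nnegrE.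
Qed.

Lemma square_integrableZ (c : R) f :
  square_integrable f -> square_integrable (fun x => c * f x).
Proof.
move=> [mf f2]; split; first by apply: measurable_funM.
by under eq_fun do rewrite exprMn; exact: integrableZl_fin.
Qed.

Lemma square_integrableD f g : square_integrable f -> square_integrable g ->
  square_integrable (fun x => f x + g x).
Proof.
move=> sf sg; have ifg := square_integrableM sf sg; move: sf sg => [mf f2] [mg g2].
split; first exact: measurable_funD.
under eq_fun do rewrite sqrrD -mulr_natl.
by apply: integrableD_fin => //; apply: integrableD_fin => //; exact: integrableZl_fin.
Qed.

Lemma square_integrableB f g : square_integrable f -> square_integrable g ->
  square_integrable (fun x => f x - g x).
Proof.
move=> sf sg; have := square_integrableD sf (square_integrableZ (-1) sg).
by under eq_fun do rewrite mulN1r.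
Qed.

Lemma square_integrable_sum (I : Type) (s : seq I) (h : I -> T -> R) :
  (forall i, square_integrable (h i)) ->
  square_integrable (fun x => \sum_(i <- s) h i x).
Proof.
move=> sh; elim: s => [|i s IH].
  by under eq_fun do rewrite big_nil; exact: square_integrable_cst.
by under eq_fun do rewrite big_cons; exact: square_integrableD.
Qed.

(** By monotone convergence the sum of the series has integral at most [C], so it is finite almost
    everywhere, and there its terms tend to 0. *)
Lemma ae_cvg0_of_sum_bounded (f : nat -> T -> R) (C : R) :
  (forall n x, 0 <= f n x) -> (forall n, int (f n)) ->
  (forall n, \sum_(i < n) \int[P]_x f i x <= C) ->
  {ae P, forall x, f ^~ x @ \oo --> 0}.
Proof.
move=> f0 intf fC.
have mf n : measurable_fun [set: T] (EFin \o f n) by case/integrableP : (intf n).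
have mser : measurable_fun [set: T] (fun x => \sum_(0 <= n <oo) (f n x)%:E)%E.
  apply: (@ge0_emeasurable_sum _ _ _ _ (fun n => EFin \o f n) xpredT) => // n x _ _.
  by rewrite lee_fin.
have int_ser : P.-integrable [set: T] (fun x => \sum_(0 <= n <oo) (f n x)%:E)%E.
  apply/integrableP; split => //.
  have ser0 x : (0 <= \sum_(0 <= n <oo) (f n x)%:E)%E.
    by apply: nneseries_ge0 => n _ _; rewrite lee_fin.
  under eq_integral do rewrite gee0_abs//.
  rewrite integral_nneseries//; last by move=> n x _; rewrite lee_fin.
  apply: (@le_lt_trans _ _ C%:E); last by rewrite ltry.
  apply: lime_le.
    by apply: is_cvg_nneseries => n _ _; apply: integral_ge0 => x _; rewrite lee_fin.
  apply: nearW => n; rewrite big_mkord.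
  under eq_bigr do rewrite Rintegral_fin//.
  by rewrite sumEFin lee_fin.
apply: filterS (integrable_ae measurableT int_ser) => x /(_ I) finx.
have cvgx : cvgn (series (f ^~ x)).
  apply: nondecreasing_is_cvgn.
    by apply: nondecreasing_series => n _ _.
  exists (fine (\sum_(0 <= n <oo) (f n x)%:E)%E) => _ [n _ <-].
  rewrite -lee_fin fineK// /series/= -sumEFin.
  by apply: nneseries_lim_ge => k _ _; rewrite lee_fin.
exact: cvg_series_cvg_0.
Qed.

End integrable_real.

(** * Pulling a nonnegative measurable weight out of a conditional inequality *)

(** The sum counts the integers from 1 to [m] that are at most [y]: it is the floor of [y] capped at
    [m]. It discretizes the weight in the pull-out lemma. *)
Lemma staircase_le (R : realDomainType) (y : R) m : 0 <= y ->
  \sum_(k < m) (k.+1%:R <= y)%R%:R <= y.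
Proof.
move=> y0; elim: m => [|m IH]; first by rewrite big_ord0.
rewrite big_ord_recr/=; have [my|my] := leP m.+1%:R y; last by rewrite addr0.
apply: le_trans my; rewrite -natr1 lerD2r.
have -> : m%:R = \sum_(k < m) 1 :> R by rewrite sumr_const card_ord.
by apply: ler_sum => i _; rewrite lern1 leq_b1.
Qed.

Lemma staircase_ge (R : realDomainType) (y : R) m : y <= m%:R ->
  y - 1 <= \sum_(k < m) (k.+1%:R <= y)%R%:R.
Proof.
elim: m => [|m IH] ym; first by rewrite big_ord0; lra.
rewrite big_ord_recr/=; have [ym'|my] := leP y m%:R.
  by apply: le_trans (IH ym') _; rewrite lerDl.
rewrite (eq_bigr (fun=> 1%:R)) => [|i _].
  rewrite sumr_const card_ord -[X in X <= _]addr0 lerD//.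
  by move: ym; rewrite -natr1 lerBlDr.
by rewrite (le_trans _ (ltW my))// ler_nat.
Qed.

Section pull_out.
Context {d : measure_display} {T : measurableType d} {R : realType}.
Variable P : probability T R.
Implicit Types f g : T -> R.

Notation "'int' f" := (P.-integrable [set: T] (EFin \o f)) (at level 10, f at level 9).

(* One half of "E[Z * xi] = E[Z * E[xi | G]]", for E[xi | G] <= 0 and Z >= 0
   measurable for G, without ever forming the conditional expectation. *)
Lemma Rintegral_pull_out_le0 (G : set (set T)) (xi Z : T -> R) :
  G `<=` measurable -> int xi ->
  (forall A, G A -> \int[P]_(x in A) xi x <= 0) ->
  (forall c, G [set x | c <= Z x]) -> (forall x, 0 <= Z x) ->
  int (fun x => Z x * xi x) ->
  \int[P]_x (Z x * xi x) <= 0.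
Proof.
move=> Gm intxi xi0 GZ Z0 intZxi.
(* Layer-cake approximation: [Zn n] is [Z] rounded down to a multiple of 1/(n+1) and capped at n+1,
   hence the (n+1)^2 levels. It is a nonnegative combination of indicators of sets of [G], for which
   the sign of the integral is the hypothesis. *)
pose A n k := [set x | k.+1%:R / n.+1%:R <= Z x] : set T.
have mA n k : measurable (A n k) by exact/Gm/GZ.
pose Zn n x := n.+1%:R^-1 * \sum_(k < n.+1 ^ 2) \1_(A n k) x : R.
have ZnE n x : Zn n x =
    n.+1%:R^-1 * \sum_(k < n.+1 ^ 2) (k.+1%:R <= Z x * n.+1%:R)%R%:R.
  congr (_ * _); apply: eq_bigr => k _; rewrite indicE; congr (nat_of_bool _)%:R.
  by apply/idP/idP; rewrite in_setE /A/= ler_pdivrMr.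
have Zn0 n x : 0 <= Zn n x by rewrite ZnE mulr_ge0// sumr_ge0.
have ZnZ n x : Zn n x <= Z x.
  rewrite ZnE mulrC ler_pdivrMr//; apply: staircase_le.
  by rewrite mulr_ge0.
have ZnZ' n x : Z x <= n.+1%:R -> Z x - n.+1%:R^-1 <= Zn n x.
  move=> Zxn; rewrite ZnE -(ler_pM2l (ltr0Sn R n)) mulrBr mulVKf// divff//.
  rewrite mulrC; apply: staircase_ge.
  by rewrite expnS expn1 natrM ler_pM2r.
have cvgZn x : Zn n x @[n --> \oo] --> Z x.
  apply: (@squeeze_cvgr _ _ _ _ (fun n => Z x - n.+1%:R^-1) (fun=> Z x)).
  - near=> n; rewrite ZnZ andbT; apply: ZnZ'.
    near: n; exists (Num.trunc (Z x)) => // n /= Zn1.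
    apply: ltW; apply: (lt_le_trans (truncnS_gt _)).
    by rewrite ler_nat ltnS.
  - rewrite -[X in _ --> X]subr0; apply: cvgB; first exact: cvg_cst.
    exact: cvg_harmonic.
  - exact: cvg_cst.
have mxi := integrable_measurable intxi.
have mZn n : measurable_fun [set: T] (fun x => Zn n x * xi x).
  apply: measurable_funM => //; apply: measurable_funM => //.
  by apply: measurable_sum => k; exact: measurable_indic.
have intZn n : \int[P]_x (Zn n x * xi x) <= 0.
  rewrite /Zn; under eq_Rintegral do rewrite -mulrA mulr_suml.
  have intA k : int (fun x => \1_(A n k) x * xi x) by exact: integrable_indicM.
  rewrite RintegralZl//; last exact: integrable_sum_fin.
  rewrite Rintegral_sum// mulr_ge0_le0// sumr_le0// => k _.
  by rewrite -Rintegral_indicM//; apply/xi0/GZ.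
have intZn' n : int (fun x => Zn n x * xi x).
  apply: le_integrable_fin (integrable_norm intZxi) => //.
  by move=> x; rewrite /= [leLHS]normrM [leRHS]normrM ler_wpM2r// !ger0_norm.
(* As 0 <= [Zn n] <= [Z], the function |[Z] [xi]| dominates, and the sign survives the limit. *)
have [|||||_ _ cvgint] := @dominated_convergence _ _ _ P _ measurableT
    (fun n x => (Zn n x * xi x)%:E) (fun x => (Z x * xi x)%:E)
    (fun x => `|Z x * xi x|%:E).
  - by move=> n; apply/measurable_EFinP.
  - by case/integrableP : intZxi.
  - apply: aeW => x _; apply: cvg_EFin; first exact: nearW.
    exact: (cvgMl (cvgZn x)).
  - exact: integrable_norm.
  - apply: aeW => x n _; rewrite lee_fin [leLHS]normrM [leRHS]normrM ler_wpM2r//.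
    by rewrite !ger0_norm.
apply/fine_le0.
rewrite -(cvg_lim _ cvgint)//; apply: lime_le; first by apply/cvg_ex; eexists; exact: cvgint.
by apply: nearW => n /=; rewrite Rintegral_fin// lee_fin.
Unshelve. all: by end_near. Qed.

End pull_out.

(** * Inequalities for finite sums *)

(** A crude form of Cauchy-Schwarz: each use of (x + y)^2 <= 2x^2 + 2y^2 doubles the constant, and
    only its finiteness matters. *)
Lemma sqr_sum_le (R : realFieldType) (I : Type) (s : seq I) (a : I -> R) :
  (\sum_(i <- s) a i) ^+ 2 <= 2 ^+ size s * \sum_(i <- s) a i ^+ 2.
Proof.
elim: s => [|i s IH]; first by rewrite !big_nil expr0n mulr0.
rewrite !big_cons /= [2 ^+ _]exprS.
have s0 : 0 <= \sum_(j <- s) a j ^+ 2 by apply: sumr_ge0 => j _; exact: sqr_ge0.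
have p1 : 1 <= 2 ^+ size s :> R by rewrite exprn_ege1// ler1n.
have := sqr_ge0 (a i - \sum_(j <- s) a j); have := sqr_ge0 (a i).
move: IH s0 p1; move: (\sum_(j <- s) a j) (\sum_(j <- s) a j ^+ 2) (2 ^+ size s) => u v p.
move=> uv v0 p1 a0 au.
have : 0 <= (p - 1) * a i ^+ 2 by apply: mulr_ge0 => //; lra.
by move: uv au; rewrite !expr2; lra.
Qed.

(** The term t = 0 vanishes because the inverse of 0 is 0. In the constant 6, the telescoped part
    accounts for 4 and the boundary term, with (n+2)/(n+1)^2 <= 2, for the other 2. *)
Lemma sum_div_sqr_bounded (R : realFieldType) (a : nat -> R) (b : R) :
  (forall t, 0 <= a t) -> (forall n, \sum_(t < n) a t <= b * n%:R) ->
  forall n, \sum_(t < n) a t * (t%:R ^+ 2)^-1 <= 6 * b.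
Proof.
move=> a0 Sb.
have b0 : 0 <= b by have := Sb 1%N; rewrite mulr1; apply: le_trans; exact: sumr_ge0.
(* Abel summation, the differences of 1/t^2 being dominated by those of 1/t. *)
have abel n : \sum_(t < n.+2) a t * (t%:R ^+ 2)^-1 <=
    (\sum_(t < n.+2) a t) / n.+1%:R ^+ 2 + 4 * b * (1 - n.+1%:R^-1).
  elim: n => [|n IH].
    rewrite !big_ord_recl !big_ord0 /= expr0n invr0 expr1n !invr1; have := a0 0%N; lra.
  rewrite big_ord_recr [\sum_(t < n.+3) a t]big_ord_recr /=.
  have := Sb n.+2; have : 0 <= \sum_(t < n.+2) a t by exact: sumr_ge0.
  move: IH; move: (\sum_(t < n.+2) a t) => s; move: (\sum_(t < n.+2) _) => F IH s0.
  rewrite -[n.+2%:R]natr1; have : 1 <= n.+1%:R :> R by rewrite ler1n.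
  move: n.+1%:R IH => x IH x1 sb; move: (a n.+2) => y.
  rewrite mulrDl -!exprVn; move: IH; rewrite -exprVn.
  have xu : x * x^-1 = 1 by rewrite mulfV//; lra.
  have xv : (x + 1) * (x + 1)^-1 = 1 by rewrite mulfV//; lra.
  have u0 : 0 <= x^-1 by rewrite invr_ge0; lra.
  have v0 : 0 <= (x + 1)^-1 by rewrite invr_ge0; lra.
  move: (x^-1) ((x + 1)^-1) xu xv u0 v0 => u v xu xv u0 v0 IH.
  have uv : u - v = u * v.
    have -> : u - v = u * ((x + 1) * v) - x * u * v by rewrite xu xv; ring.
    by ring.
  have vu : v <= u by have := mulr_ge0 u0 v0; lra.
  suff : s * (u ^+ 2 - v ^+ 2) <= 4 * b * (u - v) by lra.
  have -> : u ^+ 2 - v ^+ 2 = u * v * (u + v) by rewrite -uv; ring.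
  rewrite uv; have uv0 := mulr_ge0 u0 v0.
  (* The partial sum is at most b(x + 1) <= 2bx, and v <= u. *)
  apply: (@le_trans _ _ (2 * b * x * (u * v * (u + u)))).
    apply: ler_pM => //; [by apply: mulr_ge0 => //; lra| nra |].
    by apply: ler_wpM2l => //; lra.
  have -> : 2 * b * x * (u * v * (u + u)) = 4 * b * (x * u) * (u * v) by ring.
  by rewrite xu mulr1.
case=> [|[|n]]; first by rewrite big_ord0; lra.
  by rewrite big_ord_recl big_ord0 /= expr0n invr0; lra.
apply: le_trans (abel n) _.
have n1 : 1 <= n.+1%:R :> R by rewrite ler1n.
have nV : 0 <= (n.+1%:R : R)^-1 by [].
have : (\sum_(t < n.+2) a t) / n.+1%:R ^+ 2 <= 2 * b.
  rewrite ler_pdivrMr ?exprn_gt0//; apply: le_trans (Sb n.+2) _.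
  rewrite -[n.+2%:R]natr1 [2 * b]mulrC -mulrA ler_wpM2l//; nra.
have := mulr_ge0 b0 nV; move: (_ / n.+1%:R ^+ 2) (n.+1%:R^-1) => r u bu ru.
have -> : 4 * b * (1 - u) = 4 * b - 4 * (b * u) by ring.
lra.
Qed.

(** * Deterministic comparison of the Lyapunov function, its square root and the l1 norm *)

Section lyapunov.
Variables (R : realType) (K : nat) (w : 'I_K -> R).
Hypothesis w_gt0 : forall k, 0 < w k.
Implicit Types q : 'I_K -> R.

Definition l1norm q : R := \sum_(k < K) `|q k|.

(** The summand 1 makes the constant at most its own square, so it serves for the Lyapunov function
    and for its square root alike. *)
Definition wbound : R := 1 + \sum_(k < K) w k.

Lemma l1norm_ge0 q : 0 <= l1norm q. Proof. exact: sumr_ge0. Qed.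

Lemma le_l1norm q k : `|q k| <= l1norm q.
Proof. by rewrite /l1norm (bigD1 k)//= lerDl sumr_ge0. Qed.

Lemma wbound_ge1 : 1 <= wbound.
Proof. by rewrite lerDl sumr_ge0// => k _; exact: ltW. Qed.

Lemma lyap_ge0 q : 0 <= lyap w q.
Proof.
by rewrite mulr_ge0// sumr_ge0// => k _; rewrite mulr_ge0 ?sqr_ge0// ltW.
Qed.

Lemma qnorm_ge0 q : 0 <= qnorm w q. Proof. exact: sqrtr_ge0. Qed.

Lemma sqr_qnorm q : qnorm w q ^+ 2 = lyap w q.
Proof. exact/sqr_sqrtr/lyap_ge0. Qed.

(** With d = q' - q, the k-th term of the increment is w_k (q_k d_k + d_k^2 / 2); the coordinates of
    q and d are bounded by their l1 norms. *)
Lemma lyap_diff_le q q' : `|lyap w q' - lyap w q| <=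
  wbound * (l1norm q * l1norm (fun k => q' k - q k) +
            l1norm (fun k => q' k - q k) ^+ 2).
Proof.
set S := l1norm q; set s := l1norm _.
have -> : lyap w q' - lyap w q =
    \sum_(k < K) w k * (q k * (q' k - q k) + 2^-1 * (q' k - q k) ^+ 2).
  rewrite /lyap -mulrBr -sumrB mulr_sumr; by apply: eq_bigr => k _; field.
apply: (@le_trans _ _ (\sum_(k < K) w k * (S * s + s ^+ 2))).
  apply: le_trans (ler_norm_sum _ _ _) _; apply: ler_sum => k _.
  rewrite normrM (gtr0_norm (w_gt0 k)) ler_wpM2l ?(ltW (w_gt0 k))//.
  have qS : `|q k| <= S := le_l1norm q k.
  have ds : `|q' k - q k| <= s := le_l1norm (fun k => q' k - q k) k.
  apply: le_trans (ler_normD _ _) _; apply: lerD; first by rewrite normrM ler_pM.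
  rewrite ger0_norm; last by rewrite mulr_ge0 ?sqr_ge0.
  have : (q' k - q k) ^+ 2 <= s ^+ 2.
    by rewrite -real_normK ?num_real// lerXn2r ?nnegrE// (le_trans _ ds).
  by have := sqr_ge0 (q' k - q k); lra.
rewrite -mulr_suml ler_wpM2r//; last by rewrite /wbound; lra.
by rewrite addr_ge0 ?sqr_ge0// mulr_ge0// l1norm_ge0.
Qed.

Lemma lyap_le q : lyap w q <= wbound * l1norm q ^+ 2.
Proof.
have := lyap_diff_le (fun=> 0) q.
have -> : lyap w (fun=> 0) = 0.
  by rewrite /lyap big1 ?mulr0// => k _; rewrite expr0n mulr0.
have -> : l1norm (fun=> 0 : R) = 0 by rewrite /l1norm big1// => k _; rewrite normr0.
have -> : (fun k => q k - 0) = q by apply/funext => k; rewrite subr0.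
by rewrite mul0r add0r subr0; apply: le_trans; exact: ler_norm.
Qed.

Lemma qnorm_le q : qnorm w q <= wbound * l1norm q.
Proof.
have W1 := wbound_ge1; have S0 := l1norm_ge0 q.
rewrite -(@ler_pXn2r _ 2)// ?nnegrE ?qnorm_ge0//; last by apply: mulr_ge0 => //; lra.
rewrite sqr_qnorm; apply: le_trans (lyap_le q) _.
rewrite exprMn ler_wpM2r ?sqr_ge0//; nra.
Qed.

(** Each q_k^2 is at most 2L/w_k. The 1 added to the sum of inverse weights keeps the constant
    positive even for [K] = 0. *)
Lemma sqr_l1norm_le : exists2 C, 0 < C & forall q, l1norm q ^+ 2 <= C * lyap w q.
Proof.
set p : R := 2 ^+ size (index_enum 'I_K).
pose V := \sum_(k < K) (w k)^-1.
have p0 : 0 < p by exact: exprn_gt0.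
have V0 : 0 <= V by apply: sumr_ge0 => k _; rewrite invr_ge0 ltW.
exists (p * (2 * V + 1)); first by rewrite mulr_gt0//; lra.
move=> q; apply: le_trans (sqr_sum_le _ _) _; rewrite -/p -mulrA ler_pM2l//.
apply: (@le_trans _ _ (\sum_(k < K) (w k)^-1 * (2 * lyap w q))).
  apply: ler_sum => k _; rewrite real_normK ?num_real//.
  rewrite -[leLHS](mulKf (lt0r_neq0 (w_gt0 k))) ler_pM2l ?invr_gt0//.
  rewrite /lyap [leRHS]mulrA mulfV// mul1r (bigD1 k)//= lerDl sumr_ge0// => j _.
  by rewrite mulr_ge0 ?sqr_ge0// ltW.
by rewrite -mulr_suml -/V; have := lyap_ge0 q; lra.
Qed.

(** Applied to increments, this turns fourth moments of coordinates into second and fourth moments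
    of the l1 norm. The first bound rests on y^2 <= 1 + y^4. *)
Lemma l1norm_pow4_le : exists2 C, 0 < C & forall q,
  l1norm q ^+ 2 <= C * (1 + \sum_(k < K) q k ^+ 4) /\
  l1norm q ^+ 4 <= C * \sum_(k < K) q k ^+ 4.
Proof.
set p : R := 2 ^+ size (index_enum 'I_K).
have p1 : 1 <= p by apply: exprn_ege1; lra.
exists (p ^+ 3 + p * K%:R); first by rewrite ltr_pwDl ?exprn_gt0// ?mulr_ge0//; lra.
move=> q.
have pw2 : l1norm q ^+ 2 <= p * \sum_(k < K) q k ^+ 2.
  apply: le_trans (sqr_sum_le _ _) _; rewrite -/p ler_wpM2l//; first by lra.
  by apply: ler_sum => k _; rewrite real_normK ?num_real.
have pw4 : (\sum_(k < K) q k ^+ 2) ^+ 2 <= p * \sum_(k < K) q k ^+ 4.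
  apply: le_trans (sqr_sum_le _ _) _; rewrite -/p ler_wpM2l//; first by lra.
  by apply: ler_sum => k _; rewrite -exprM.
have pw24 : \sum_(k < K) q k ^+ 2 <= K%:R + \sum_(k < K) q k ^+ 4.
  have -> : K%:R = \sum_(k < K) 1 :> R by rewrite sumr_const card_ord.
  rewrite -big_split/=; apply: ler_sum => k _.
  by have := sqr_ge0 (q k ^+ 2 - 2^-1); rewrite (exprM _ 2 2); lra.
have K0 : 0 <= K%:R :> R by [].
have pK : 0 <= p * K%:R by rewrite mulr_ge0//; lra.
have p3 : p <= p ^+ 3 by rewrite ler_eXnr.
have v0 : 0 <= \sum_(k < K) q k ^+ 4.
  by apply: sumr_ge0 => k _; rewrite (exprM _ 2 2) sqr_ge0.
have u0 : 0 <= \sum_(k < K) q k ^+ 2 by apply: sumr_ge0 => k _; rewrite sqr_ge0.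
move: (\sum_(k < K) q k ^+ 2) (\sum_(k < K) q k ^+ 4) pw2 pw4 pw24 v0 u0 => u v.
move=> pw2 pw4 pw24 v0 u0; split.
  apply: le_trans pw2 _; nra.
rewrite (exprM _ 2 2); apply: (@le_trans _ _ ((p * u) ^+ 2)).
  by rewrite lerXn2r// nnegrE ?sqr_ge0// mulr_ge0//; lra.
apply: (@le_trans _ _ (p ^+ 3 * v)); last by rewrite mulrDl lerDl mulr_ge0.
by rewrite exprMn [p ^+ 3]exprSr -mulrA ler_pM2l// exprn_gt0//; lra.
Qed.

End lyapunov.

(** * Limits of real sequences and averages along the squares *)

Lemma cvg0_sqr (R : realType) (u : nat -> R) :
  u n ^+ 2 @[n --> \oo] --> 0 -> u n @[n --> \oo] --> 0.
Proof.
move=> u2; apply/cvgr0Pnorm_lt => e e0.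
have e2 : 0 < e ^+ 2 by exact: exprn_gt0.
have /cvgr0Pnorm_lt/(_ _ e2) := u2; apply: filterS => n.
by rewrite normrX ltr_pXn2r// nnegrE ltW.
Qed.

Lemma nat_sqrt_ex n : exists j, (j ^ 2 <= n < j.+1 ^ 2)%N.
Proof.
elim: n => [|n [j /andP[jn nj]]]; first by exists 0%N.
have [nj'|nj'] := ltnP n.+1 (j.+1 ^ 2).
  by exists j; rewrite nj' (leq_trans jn).
by exists j.+1; rewrite nj'/=; apply: (leq_ltn_trans nj); rewrite ltn_exp2r.
Qed.

Lemma limn_esup_le_near (R : realType) (u : nat -> \bar R) (l : \bar R) :
  (\forall n \near \oo, u n <= l)%E -> (limn_esup u <= l)%E.
Proof.
move=> [n0 _ ul]; rewrite limn_esup_lim; apply: lime_le; first exact: is_cvg_esups.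
exists n0 => // n /= n0n; apply: ge_ereal_sup => _ [k /= nk <-].
by apply: ul => /=; exact: leq_trans nk.
Qed.

(* Partial sums are monotone, so their averages are controlled by those along the
   squares, whose ratio of consecutive terms tends to 1. *)
Lemma limn_esup_average_squares (R : realType) (S m : nat -> R) (c l e : R) :
  (forall t, 0 <= S t) -> 0 < e ->
  (forall n, e * \sum_(t < n) S t <= l * n%:R + c + m n) ->
  m (j ^ 2)%N / (j ^ 2)%:R @[j --> \oo] --> 0 ->
  (limn_esup (fun n => (n%:R^-1 * \sum_(t < n) S t)%:E) <= (l / e)%:E)%E.
Proof.
move=> S0 e0 Sm m0; pose B n := \sum_(t < n) S t.
have B0 n : 0 <= B n by exact: sumr_ge0.
have Bmono n n' : (n <= n')%N -> B n <= B n'.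
  move=> nn'; rewrite /B -(subnKC nn') big_split_ord/= lerDl.
  exact: sumr_ge0.
(* [g j] bounds the average at time (j+1)^2, and [h j] all averages from (j+1)^2 up to (j+2)^2; its
   extra factor is the ratio of these two squares. *)
pose g j := e^-1 * (l + c * (j.+1%:R^-1 * j.+1%:R^-1) + m (j.+1 ^ 2)%N / (j.+1 ^ 2)%:R).
pose h j := g j.+1 * ((1 + j.+1%:R^-1) * (1 + j.+1%:R^-1)).
have Bg j : B (j.+1 ^ 2)%N / (j.+1 ^ 2)%:R <= g j.
  have x0 : 0 < (j.+1 ^ 2)%:R :> R by rewrite ltr0n expn_gt0.
  rewrite /g -(ler_pM2l e0) mulVKf ?gt_eqF// mulrA ler_pdivrMr//.
  apply: le_trans (Sm _) _; rewrite le_eqVlt; apply/orP; left; apply/eqP.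
  by rewrite -invfM -natrM mulnn; field; rewrite gt_eqF.
have Bh j n : (j.+1 ^ 2 <= n < j.+2 ^ 2)%N -> n%:R^-1 * B n <= h j.
  move=> /andP[jn nj].
  have x0 : 0 < (j.+1 ^ 2)%:R :> R by rewrite ltr0n expn_gt0.
  have y0 : 0 < (j.+2 ^ 2)%:R :> R by rewrite ltr0n expn_gt0.
  apply: (@le_trans _ _ ((j.+1 ^ 2)%:R^-1 * B (j.+2 ^ 2)%N)).
    apply: ler_pM => //; last exact/Bmono/ltnW.
    by rewrite lef_pV2 ?posrE ?ler_nat// ltr0n (leq_trans _ jn)// expn_gt0.
  have -> : (j.+1 ^ 2)%:R^-1 * B (j.+2 ^ 2)%N =
      B (j.+2 ^ 2)%N / (j.+2 ^ 2)%:R * ((1 + j.+1%:R^-1) * (1 + j.+1%:R^-1)).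
    rewrite !natrX -[j.+2%:R]natr1.
    have : 0 < j.+1%:R :> R by []; move: j.+1%:R => x xgt0.
    by field; rewrite !gt_eqF// addr_gt0.
  by apply: ler_wpM2r => //; apply: mulr_ge0; apply: addr_ge0.
have cvgg : g j @[j --> \oo] --> l / e.
  rewrite [l / e]mulrC; apply: cvgMr.
  rewrite -[X in _ --> X]addr0; apply: cvgD.
    rewrite -[X in _ --> X]addr0; apply: cvgD; first exact: cvg_cst.
    have : c * (j.+1%:R^-1 * j.+1%:R^-1) @[j --> \oo] --> c * (0 * 0).
      by apply: cvgMr; apply: cvgM; exact: cvg_harmonic.
    by rewrite !mulr0.
  by have := m0; rewrite -(cvg_shiftS (fun j => m (j ^ 2)%N / (j ^ 2)%:R)).
have cvgh : h j @[j --> \oo] --> l / e.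
  have c1 : 1 + j.+1%:R^-1 @[j --> \oo] --> (1 : R).
    rewrite -[X in _ --> X]addr0; apply: cvgD; first exact: cvg_cst.
    exact: cvg_harmonic.
  have : h j @[j --> \oo] --> l / e * (1 * 1).
    by apply: cvgM; [rewrite (cvg_shiftS g)|exact: cvgM].
  by rewrite !mulr1.
apply/lee_addgt0Pr => r r0; rewrite -EFinD; apply: limn_esup_le_near.
have lr : l / e < l / e + r by rewrite ltrDl.
have /cvgr_le/(_ _ lr)[J _ hJ] := cvgh.
exists (J.+1 ^ 2)%N => // n /= Jn; rewrite lee_fin.
(* The integer square root of n is at least 1 here, so it can be written j+1. *)
have [[|j] jn] := nat_sqrt_ex n.
  by have := leq_trans (leq_ltn_trans Jn (proj2 (andP jn))) (leqnn _); rewrite ltnNge expn_gt0.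
apply: le_trans (Bh _ _ jn) _; apply: hJ => /=.
have : (J.+1 ^ 2 < j.+2 ^ 2)%N by apply: leq_ltn_trans Jn _; case/andP: jn.
by rewrite ltn_exp2r// !ltnS.
Qed.

(** * Sigma-algebras generated by families of functions *)

Section gen_sigma_theory.
Context {d : measure_display} {T : measurableType d} {R : realType}.
Implicit Types (fs gs : set (T -> R)) (f : T -> R).

(* [gen_sigma fs] is, up to conversion, the sigma-algebra of this type, so that the
   library closure properties of [measurable_fun] apply to it. *)
Definition gen_sigmaType fs : Type :=
  g_sigma_algebraType [set f @^-1` B | f in fs & B in [set B : set R | measurable B]].

HB.instance Definition _ fs := Measurable.on (gen_sigmaType fs).

Lemma gen_sigma_measurable fs : (forall f, fs f -> measurable_fun [set: T] f) ->
  gen_sigma fs `<=` measurable.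
Proof.
move=> mfs; apply: smallest_sub; first exact: sigma_algebra_measurable.
move=> _ [f fsf [B mB <-]]; rewrite -[X in measurable X]setTI.
exact: mfs.
Qed.

Lemma gen_sigma_mono fs gs : fs `<=` gs -> gen_sigma fs `<=` gen_sigma gs.
Proof.
move=> fg; apply: sub_sigma_algebra2 => _ [f fsf [B mB <-]].
by exists f; [exact: fg|exists B].
Qed.

Lemma measurable_gen_sigma fs f : fs f ->
  measurable_fun [set: gen_sigmaType fs] (f : gen_sigmaType fs -> R).
Proof.
move=> fsf _ B mB; rewrite setTI; apply: sub_sigma_algebra.
by exists f => //; exists B.
Qed.

Lemma gen_sigma_ge fs f :
  measurable_fun [set: gen_sigmaType fs] (f : gen_sigmaType fs -> R) ->
  forall c, gen_sigma fs [set x | c <= f x].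
Proof.
move=> mf c; have -> : [set x | c <= f x] = f @^-1` `[c, +oo[.
  by apply/seteqP; split => x /=; rewrite in_itv/= andbT.
by have := mf measurableT _ (measurable_itv `[c, +oo[); rewrite setTI.
Qed.

End gen_sigma_theory.

(** * From versions of conditional expectations to integral inequalities *)

Section cond_exp_version_theory.
Context {d : measure_display} {T : measurableType d} {R : realType}.
Variable P : probability T R.
Implicit Types X Y U : T -> R.

Notation "'int' f" := (P.-integrable [set: T] (EFin \o f)) (at level 10, f at level 9).

Lemma Rintegral_ae_le U Y (A : set T) : measurable A -> int U -> int Y ->
  {ae P, forall x, Y x <= U x} -> \int[P]_(x in A) Y x <= \int[P]_(x in A) U x.
Proof.
move=> mA intU intY YU.
have mYU : measurable_fun A (fun x => U x - Y x).
  by apply: measurable_funTS; apply: measurable_funB;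
    [exact: integrable_measurable intU|exact: integrable_measurable intY].
have intUA : P.-integrable A (EFin \o U) by exact: integrableS intU.
have intYA : P.-integrable A (EFin \o Y) by exact: integrableS intY.
rewrite -subr_ge0 -RintegralB//; apply: fine_ge0.
(* The difference agrees almost everywhere with its positive part, whose integral is visibly
   nonnegative. *)
rewrite (@ae_eq_integral _ _ _ P A (fun x => (Num.max (U x - Y x) 0)%:E))//.
- by apply: integral_ge0 => x _; rewrite lee_fin le_max lexx orbT.
- exact/measurable_EFinP.
- by apply/measurable_EFinP; exact: measurable_maxr.
- apply: filterS YU => x YUx _; congr EFin; symmetry; apply/max_idPl.
  by rewrite subr_ge0.
Qed.

(** Puts an almost sure bound on a conditional expectation into the form that
    [Rintegral_pull_out_le0] takes as hypothesis. *)
Lemma cond_exp_version_le (G : set (set T)) X Y U : G `<=` measurable ->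
  cond_exp_version P G X Y -> int U -> {ae P, forall x, Y x <= U x} ->
  forall A, G A -> \int[P]_(x in A) (X x - U x) <= 0.
Proof.
move=> Gm [intX _ intY XY] intU YU A GA; have mA := Gm _ GA.
have intUA : P.-integrable A (EFin \o U) by exact: integrableS intU.
have intXA : P.-integrable A (EFin \o X) by exact: integrableS intX.
rewrite RintegralB// subr_le0.
have -> : \int[P]_(x in A) X x = \int[P]_(x in A) Y x by rewrite /Rintegral XY.
exact: Rintegral_ae_le.
Qed.

(** The integral of |[X]| over [A] vanishes, so [X] is 0 almost everywhere on [A], against its
    positivity there. *)
Lemma Rintegral_gt0_negligible (A : set T) X : measurable A -> int X ->
  (forall x, A x -> 0 < X x) -> \int[P]_(x in A) X x <= 0 ->
  {ae P, forall x, ~ A x}.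
Proof.
move=> mA intX X0 intX0.
have intXA : P.-integrable A (EFin \o X) by exact: integrableS intX.
have /integrableP[mX _] := intXA.
have /ae_eq_integral_abs : (\int[P]_(x in A) `|(X x)%:E| = 0)%E.
  apply/eqP; rewrite eq_le integral_ge0// andbT.
  rewrite (eq_integral (EFin \o X)) => [|x]; last first.
    by rewrite inE => Ax; rewrite /= gtr0_norm// X0.
  rewrite -(@fineK _ (integral _ _ _)) ?integrable_fin_num//.
move=> /(_ mA mX); apply: filterS => x /= X0x Ax; have [X0x'] := X0x Ax.
by have := X0 _ Ax; rewrite X0x' ltxx.
Qed.

End cond_exp_version_theory.

(** * Measurability of the norms of a random vector *)

Section measurable_vector.
Context {d : measure_display} {T : measurableType d} {R : realType} {K : nat}.
Variables (w : 'I_K -> R) (q : 'I_K -> T -> R).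
Hypothesis mq : forall k, measurable_fun [set: T] (q k).

Lemma measurable_l1norm : measurable_fun [set: T] (fun x => l1norm (q ^~ x)).
Proof. by apply: measurable_sum => k; exact: measurableT_comp. Qed.

Lemma measurable_lyap : measurable_fun [set: T] (fun x => lyap w (q ^~ x)).
Proof.
apply: measurable_funM => //; apply: measurable_sum => k.
by apply: measurable_funM => //; exact: measurable_funX.
Qed.

Lemma measurable_qnorm : measurable_fun [set: T] (fun x => qnorm w (q ^~ x)).
Proof.
have := continuous_measurable_fun (@sqrt_continuous R).
by move=> /measurableT_comp; apply; exact: measurable_lyap.
Qed.

End measurable_vector.

(** * The process under the moment and drift hypotheses *)

Section drift.
Context {d : measure_display} {T : measurableType d} {R : realType}.
Variables (P : probability T R) (K : nat).
Variables (Q : nat -> 'I_K -> T -> R) (p : nat -> T -> R).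
Variables (w : 'I_K -> R) (D eps Bt : R).
Hypothesis mQ : forall t k, measurable_fun [set: T] (Q t k).
Hypothesis mp : forall t, measurable_fun [set: T] (p t).
Hypothesis w_gt0 : forall k, 0 < w k.

Notation "'int' f" := (P.-integrable [set: T] (EFin \o f)) (at level 10, f at level 9).

Let present t : set (T -> R) := [set Q t j | j in [set: 'I_K]].
Let history t : set (T -> R) :=
  [set Q s j | s in [set s | (s <= t)%N] & j in [set: 'I_K]]
    `|` [set p s | s in [set s | (s < t)%N]].

Hypothesis jump_moment : forall t k, exists Y : T -> R,
  cond_exp_version P (gen_sigma (present t))
    (fun x => (Q t.+1 k x - Q t k x) ^+ 4) Y /\
  {ae P, forall x, Y x <= D}.
Hypothesis init_moment :
  (\int[P]_x ((qnorm w (fun k => Q 0%N k x)) ^+ 4)%:E < +oo)%E.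
Hypothesis eps_gt0 : 0 < eps.
Hypothesis Bt_gt0 : 0 < Bt.
Hypothesis lyap_drift : forall t, exists Y : T -> R,
  cond_exp_version P (gen_sigma (history t))
    (fun x => lyap w (fun k => Q t.+1 k x) - lyap w (fun k => Q t k x)) Y /\
  {ae P, forall x, Y x <= Bt - eps * \sum_(k < K) `|Q t k x|}.

Let L t x := lyap w (Q t ^~ x).
Let N t x := qnorm w (Q t ^~ x).
Let S t x := l1norm (Q t ^~ x).
Let jump t x := l1norm (fun k => Q t.+1 k x - Q t k x).
(** The excess of the Lyapunov increment over its drift bound: its conditional mean given the
    history is at most 0, so these are supermartingale increments. *)
Let xi t x := L t.+1 x - L t x - (Bt - eps * S t x).

Let L_ge0 t x : 0 <= L t x. Proof. exact: lyap_ge0. Qed.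
Let N_ge0 t x : 0 <= N t x. Proof. exact: qnorm_ge0. Qed.
Let S_ge0 t x : 0 <= S t x. Proof. exact: l1norm_ge0. Qed.
Let jump_ge0 t x : 0 <= jump t x. Proof. exact: l1norm_ge0. Qed.
Let sqrN t x : N t x ^+ 2 = L t x. Proof. exact: sqr_qnorm. Qed.

Let mL t : measurable_fun [set: T] (L t). Proof. exact: measurable_lyap. Qed.
Let mS t : measurable_fun [set: T] (S t). Proof. exact: measurable_l1norm. Qed.
Let mN t : measurable_fun [set: T] (N t). Proof. exact: measurable_qnorm. Qed.
Let mjump t : measurable_fun [set: T] (jump t).
Proof. by apply: measurable_l1norm => k; exact: measurable_funB. Qed.

Let present_measurable t : gen_sigma (present t) `<=` measurable.
Proof. by apply: gen_sigma_measurable => _ [j _ <-]. Qed.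

Let history_measurable t : gen_sigma (history t) `<=` measurable.
Proof. by apply: gen_sigma_measurable => f [[s _ [j _ <-]]|[s _ <-]]. Qed.

Let present_history t : gen_sigma (present t) `<=` gen_sigma (history t).
Proof. by apply: gen_sigma_mono => _ [j _ <-]; left; exists t => //=; exists j. Qed.

Let mQ_present t k :
  measurable_fun [set: gen_sigmaType (present t)] (Q t k : gen_sigmaType (present t) -> R).
Proof. by apply: measurable_gen_sigma; exists k. Qed.

Let mQ_history s t k : (s <= t)%N ->
  measurable_fun [set: gen_sigmaType (history t)] (Q s k : gen_sigmaType (history t) -> R).
Proof. by move=> st; apply: measurable_gen_sigma; left; exists s => //; exists k. Qed.

(** * Moments of the increments and integrability *)

Let int_jump4 t k : int (fun x => (Q t.+1 k x - Q t k x) ^+ 4).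
Proof. by have [Y [[]]] := jump_moment t k. Qed.

Let jump_sqint t : square_integrable P (fun x => jump t x ^+ 2).
Proof.
have [C C0 C4] := l1norm_pow4_le R K; split; first exact: measurable_funX.
apply: (@le_integrable_fin _ _ _ P _
  (fun x => C * \sum_(k < K) (Q t.+1 k x - Q t k x) ^+ 4)).
- by apply: measurable_funX; exact: measurable_funX.
- move=> x; rewrite -exprM ger0_norm ?exprn_ge0//.
  by have [] := C4 (fun k => Q t.+1 k x - Q t k x).
- by apply: integrableZl_fin; apply: integrable_sum_fin => k; exact: int_jump4.
Qed.

(** The second moment is needed conditionally on Q(t), because it will be multiplied by S(t)^2; for
    the fourth the plain expectation suffices. Using |[D]| keeps the constant nonnegative. *)
Let jump_moments : exists2 C, 0 <= C & forall t,
  (forall A, gen_sigma (present t) A -> \int[P]_(x in A) (jump t x ^+ 2 - C) <= 0) /\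
  \int[P]_x (jump t x ^+ 4) <= C.
Proof.
have [C C0 C4] := l1norm_pow4_le R K; exists (C * (1 + K%:R * `|D|)).
  by rewrite mulr_ge0 ?(ltW C0)// addr_ge0// mulr_ge0.
have intA t A : gen_sigma (present t) A ->
    \int[P]_(x in A) (\sum_(k < K) ((Q t.+1 k x - Q t k x) ^+ 4 - `|D|)) <= 0.
  move=> GA; have mA := present_measurable GA.
  rewrite Rintegral_indicM//; last first.
    by apply: integrable_sum_fin => k; apply: integrableB_fin => //; exact: integrable_cst_fin.
  under eq_Rintegral do rewrite mulr_sumr.
  have intk k : int (fun x => (Q t.+1 k x - Q t k x) ^+ 4 - `|D|).
    by apply: integrableB_fin => //; exact: integrable_cst_fin.
  rewrite Rintegral_sum => [|k]; last exact: integrable_indicM.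
  apply: sumr_le0 => k _; rewrite -Rintegral_indicM//.
  have [Y [YX YD]] := jump_moment t k.
  apply: (cond_exp_version_le (@present_measurable t) YX _ _ GA).
    exact: integrable_cst_fin.
  by apply: filterS YD => x /le_trans; apply; exact: ler_norm.
have sumE t x : \sum_(k < K) ((Q t.+1 k x - Q t k x) ^+ 4 - `|D|) =
    \sum_(k < K) (Q t.+1 k x - Q t k x) ^+ 4 - K%:R * `|D|.
  by rewrite sumrB sumr_const card_ord mulr_natl.
have intsum t : int (fun x => \sum_(k < K) ((Q t.+1 k x - Q t k x) ^+ 4 - `|D|)).
  by apply: integrable_sum_fin => k; apply: integrableB_fin => //; exact: integrable_cst_fin.
move=> t; split.
  move=> A GA; have mA := present_measurable GA.
  have intj : int (fun x => jump t x ^+ 2 - C * (1 + K%:R * `|D|)).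
    apply: integrableB_fin; last exact: integrable_cst_fin.
    exact: square_integrable_integrable.
  apply: (@le_trans _ _ (\int[P]_(x in A)
      (C * \sum_(k < K) ((Q t.+1 k x - Q t k x) ^+ 4 - `|D|)))).
    apply: le_Rintegral => //.
    - exact: integrableS intj.
    - by apply: (integrableS _ _ _ (integrableZl_fin C (intsum t))).
    - move=> x _; rewrite sumE; have [+ _] := C4 (fun k => Q t.+1 k x - Q t k x).
      rewrite -/(jump t x); nra.
  rewrite RintegralZl//; last exact: (integrableS _ _ _ (intsum t)).
  by rewrite mulr_ge0_le0 ?(ltW C0)// intA.
apply: (@le_trans _ _ (\int[P]_x
    (C * \sum_(k < K) ((Q t.+1 k x - Q t k x) ^+ 4 - `|D|) + C * (K%:R * `|D|)))).
  apply: le_Rintegral => //.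
  - have [_] := jump_sqint t.
    by apply: eq_integrable => // x _ /=; rewrite -exprM.
  - by apply: integrableD_fin; [exact: integrableZl_fin|exact: integrable_cst_fin].
  - move=> x _; rewrite sumE; have [_] := C4 (fun k => Q t.+1 k x - Q t k x).
    by rewrite -/(jump t x); lra.
rewrite RintegralD//; last 2 first.
- exact: integrableZl_fin.
- exact: integrable_cst_fin.
rewrite RintegralZl// Rintegral_cstT mulrDr mulr1 lerD2r (@le_trans _ _ 0) ?(ltW C0)//.
rewrite mulr_ge0_le0 ?(ltW C0)// intA//.
(* The conditional bound on the whole space is the unconditional one. *)
exact: (@measurableT _ (gen_sigmaType (present t))).
Qed.

(** Induction on time: L(0)^2 is the fourth power of the initial norm, and S(t+1) <= S(t) + [jump t]
    bounds L(t+1) by a combination of L(t) and the squared jump. *)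
Let L_sqint t : square_integrable P (L t).
Proof.
have [C C0 CL] := sqr_l1norm_le w_gt0.
elim: t => [|t IH].
  split => //; apply/integrableP; split.
    by apply/measurable_EFinP; exact: measurable_funX.
  apply: le_lt_trans init_moment; rewrite le_eqVlt; apply/orP; left; apply/eqP.
  apply: eq_integral => x _ /=; rewrite ger0_norm ?sqr_ge0//.
  by rewrite -[L 0 x]sqrN -exprM.
have W1 := wbound_ge1 w_gt0; set W := wbound w in W1; have W0 : 0 <= W by lra.
apply: (@square_integrable_le _ _ _ P _ (fun x => 2 * W * C * L t x + 2 * W * jump t x ^+ 2)) => //.
  move=> x; rewrite ger0_norm// ger0_norm; last first.
    apply: addr_ge0; last by apply: mulr_ge0; [lra|exact: sqr_ge0].
    by apply: mulr_ge0 => //; apply: mulr_ge0; lra.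
  apply: le_trans (lyap_le w_gt0 _) _; rewrite -/W -/(S t.+1 x).
  have SS : S t.+1 x <= S t x + jump t x.
    rewrite /S /l1norm -big_split/=; apply: ler_sum => k _.
    by apply: le_trans (ler_normD _ _); rewrite addrC subrK.
  have := CL (Q t ^~ x); rewrite -/(S t x) -/(L t x) => CLx.
  have S2 : S t.+1 x ^+ 2 <= (S t x + jump t x) ^+ 2 by rewrite lerXn2r// nnegrE// addr_ge0.
  have := sqr_ge0 (S t x - jump t x) => sj.
  have -> : 2 * W * C * L t x + 2 * W * jump t x ^+ 2 =
    W * (2 * (C * L t x) + 2 * jump t x ^+ 2) by ring.
  by rewrite ler_wpM2l//; move: S2 sj CLx; rewrite !expr2; lra.
by apply: square_integrableD; exact: square_integrableZ.
Qed.


Let S2_sqint t : square_integrable P (fun x => S t x ^+ 2).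
Proof.
have [C C0 CL] := sqr_l1norm_le w_gt0.
apply: square_integrable_le (square_integrableZ C (L_sqint t)).
  exact: measurable_funX.
by move=> x; rewrite !ger0_norm ?sqr_ge0//; [exact: CL|rewrite mulr_ge0// ltW].
Qed.

Let S_sqint t : square_integrable P (S t).
Proof.
apply: square_integrable_le (square_integrableD (square_integrable_cst P 1) (S2_sqint t)) => //.
move=> x; rewrite !ger0_norm//; last by rewrite addr_ge0// sqr_ge0.
by have := sqr_ge0 (S t x - 2^-1); rewrite !expr2; lra.
Qed.

Let xi_sqint t : square_integrable P (xi t).
Proof.
apply: square_integrableB; first exact: square_integrableB.
by apply: square_integrableB; [exact: square_integrable_cst|exact: square_integrableZ].
Qed.

Let intL t : int (L t). Proof. exact: square_integrable_integrable. Qed.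
Let intL2 t : int (fun x => L t x ^+ 2). Proof. exact: proj2 (L_sqint t). Qed.
Let intS2 t : int (fun x => S t x ^+ 2).
Proof. exact: square_integrable_integrable. Qed.
Let intxi t : int (xi t). Proof. exact: square_integrable_integrable. Qed.
Let intxi2 t : int (fun x => xi t x ^+ 2). Proof. exact: proj2 (xi_sqint t). Qed.

Let intN3 t : int (fun x => N t x ^+ 3).
Proof.
apply: (@le_integrable_fin _ _ _ _ _ (fun x => 1 + L t x ^+ 2)).
- exact: measurable_funX.
- move=> x; rewrite ger0_norm ?exprn_ge0// -sqrN -exprM.
  have [N1|N1] := leP (N t x) 1.
    by apply: (@le_trans _ _ 1); [exact: exprn_ile1|rewrite lerDl exprn_ge0].
  apply: (@le_trans _ _ (N t x ^+ 4)); last by rewrite lerDr.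
  by rewrite [leRHS]exprSr ler_peMr ?exprn_ge0// ltW.
- by apply: integrableD_fin => //; exact: integrable_cst_fin.
Qed.

(** * One-step drift estimates in expectation *)

Let xi_le0 t A : gen_sigma (history t) A -> \int[P]_(x in A) xi t x <= 0.
Proof.
move=> GA; have [Y [YX YU]] := lyap_drift t.
apply: (cond_exp_version_le (@history_measurable t) YX _ YU GA).
apply: integrableB_fin; first exact: integrable_cst_fin.
exact: (integrableZl_fin eps (square_integrable_integrable (S_sqint t))).
Qed.

(** With j the jump, the squared increment of L is at most 2W^2 (S^2 j^2 + j^4). As S(t)^2 is a
    function of Q(t), it is pulled out of the conditional second moment of j, leaving a multiple of
    E[S^2], hence of E[L]. *)
Let drift_sqr_le : exists2 c, 0 <= c & forall t,
  \int[P]_x ((L t.+1 x - L t x) ^+ 2) <= c * (1 + \int[P]_x L t x).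
Proof.
have [C C0 CL] := sqr_l1norm_le w_gt0.
have [C5 C50 jC] := jump_moments.
have W1 := wbound_ge1 w_gt0; set W := wbound w in W1.
have W2 : 0 <= 2 * W ^+ 2 by rewrite mulr_ge0// sqr_ge0.
exists (2 * W ^+ 2 * (C5 * (C + 1))).
  by apply: mulr_ge0 => //; apply: mulr_ge0 => //; lra.
move=> t; have [jA j4] := jC t.
have EL0 : 0 <= \int[P]_x L t x by apply: Rintegral_ge0.
have intSj : int (fun x => S t x ^+ 2 * jump t x ^+ 2) by exact: square_integrableM.
have intj4 : int (fun x => jump t x ^+ 4).
  by have [_] := jump_sqint t; apply: eq_integrable => // x _ /=; rewrite -exprM.
have intj2 : int (fun x => jump t x ^+ 2) by exact: square_integrable_integrable.
have ESj : \int[P]_x (S t x ^+ 2 * jump t x ^+ 2) <= C5 * \int[P]_x (S t x ^+ 2).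
  rewrite -subr_le0 -RintegralZl// -RintegralB//; last exact: integrableZl_fin.
  under eq_Rintegral do rewrite [C5 * _]mulrC -mulrBr.
  apply: (Rintegral_pull_out_le0 (@present_measurable t)) => //.
  - by apply: integrableB_fin => //; exact: integrable_cst_fin.
  - by apply: gen_sigma_ge; apply: measurable_funX; exact: measurable_l1norm.
  - by move=> x; exact: sqr_ge0.
  - apply: square_integrableM => //; apply: square_integrableB => //.
    exact: square_integrable_cst.
have ES : \int[P]_x (S t x ^+ 2) <= C * \int[P]_x L t x.
  rewrite -RintegralZl//; apply: le_Rintegral => //; first exact: integrableZl_fin.
  by move=> x _; exact: CL.
apply: (@le_trans _ _ (\int[P]_x
    (2 * W ^+ 2 * (S t x ^+ 2 * jump t x ^+ 2 + jump t x ^+ 4)))).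
  apply: le_Rintegral => //.
  - by have [] := square_integrableB (L_sqint t.+1) (L_sqint t).
  - by apply: integrableZl_fin; exact: integrableD_fin.
  move=> x _; have := lyap_diff_le w_gt0 (Q t ^~ x) (Q t.+1 ^~ x).
  rewrite -/(L t.+1 x) -/(L t x) -/(S t x) -/(jump t x) -/W => LW.
  rewrite -real_normK ?num_real//.
  have : `|L t.+1 x - L t x| ^+ 2 <= (W * (S t x * jump t x + jump t x ^+ 2)) ^+ 2.
    by rewrite lerXn2r// nnegrE (le_trans _ LW).
  move/le_trans; apply; rewrite exprMn -[leRHS]mulrA [leRHS]mulrCA ler_wpM2l ?sqr_ge0//.
  by have := sqr_ge0 (S t x * jump t x - jump t x ^+ 2); lra.
rewrite RintegralZl//; last exact: integrableD_fin.
rewrite RintegralD// -[leRHS]mulrA ler_wpM2l//.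
have := ler_wpM2l C50 ES; have : 0 <= C5 * C by rewrite mulr_ge0// ltW.
have := mulr_ge0 C50 EL0; lra.
Qed.

(** In L(t+1)^2 = L^2 + 2L (L(t+1) - L) + (L(t+1) - L)^2, the drift makes the cross term at most 2
    Bt L - 2r N^3 in mean, because N <= W S. The terms linear in L, of total coefficient [m], are
    absorbed by one of the two copies of r N^3. *)
Let energy_drift : exists r c, [/\ 0 < r, 0 <= c & forall t,
  \int[P]_x (L t.+1 x ^+ 2) <=
  \int[P]_x (L t x ^+ 2) + c - r * \int[P]_x (N t x ^+ 3)].
Proof.
have [c c0 dc] := drift_sqr_le.
have W1 := wbound_ge1 w_gt0; set W := wbound w in W1.
pose r := eps / W; pose m := 2 * Bt + c.
have r0 : 0 < r by rewrite divr_gt0//; lra.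
have m0 : 0 < m by rewrite /m ltr_wpDr// mulr_gt0.
exists r, (c + m ^+ 3 / r ^+ 2); split => //.
  by rewrite addr_ge0// divr_ge0// exprn_ge0// ltW.
move=> t.
(* As L = N^2, the first summand suffices when N >= m/r and the second one otherwise. *)
have young x : m * L t x <= r * N t x ^+ 3 + m ^+ 3 / r ^+ 2.
  have [Nm|Nm] := leP (m / r) (N t x).
    apply: (@le_trans _ _ (r * N t x ^+ 3)); last first.
      by rewrite lerDl divr_ge0// exprn_ge0// ltW.
    rewrite -sqrN [N t x ^+ 3]exprS mulrA ler_wpM2r ?sqr_ge0//.
    by rewrite mulrC -ler_pdivrMr.
  apply: (@le_trans _ _ (m ^+ 3 / r ^+ 2)); last first.
    by rewrite lerDr mulr_ge0 ?exprn_ge0// ltW.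
  rewrite exprS -mulrA ler_pM2l// -expr_div_n -sqrN lerXn2r ?nnegrE//.
    by rewrite divr_ge0 ?ltW.
  exact: ltW.
have NS x : r * N t x ^+ 3 <= eps * (L t x * S t x).
  have := qnorm_le w_gt0 (Q t ^~ x); rewrite -/(N t x) -/(S t x) -/W => NW.
  rewrite /r mulrAC ler_pdivrMr; last lra.
  rewrite -[leRHS]mulrA ler_pM2l// exprSr sqrN -[leRHS]mulrA ler_wpM2l//.
  by rewrite mulrC.
have ELxi : \int[P]_x (L t x * xi t x) <= 0.
  apply: (Rintegral_pull_out_le0 (@history_measurable t)) => //.
  - exact: xi_le0.
  - by apply: gen_sigma_ge; apply: measurable_lyap => k; exact: mQ_history.
  - exact: square_integrableM.
have intLxi : int (fun x => L t x * xi t x) by exact: square_integrableM.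
have intD2 : int (fun x => (L t.+1 x - L t x) ^+ 2).
  by have [] := square_integrableB (L_sqint t.+1) (L_sqint t).
have Em : m * \int[P]_x L t x <= r * \int[P]_x (N t x ^+ 3) + m ^+ 3 / r ^+ 2.
  rewrite -!RintegralZl// -[m ^+ 3 / r ^+ 2](Rintegral_cstT P).
  rewrite -RintegralD//; last 2 first.
  - exact: integrableZl_fin.
  - exact: integrable_cst_fin.
  apply: le_Rintegral => //; first exact: integrableZl_fin.
  by apply: integrableD_fin; [exact: integrableZl_fin|exact: integrable_cst_fin].
have int1 : int (fun x => L t x ^+ 2 + 2 * (L t x * xi t x)).
  by apply: integrableD_fin => //; exact: integrableZl_fin.
have int2 : int (fun x => 2 * Bt * L t x - 2 * r * N t x ^+ 3).
  by apply: integrableB_fin; exact: integrableZl_fin.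
have int3 : int (fun x => L t x ^+ 2 + 2 * (L t x * xi t x) +
    (2 * Bt * L t x - 2 * r * N t x ^+ 3)) by exact: integrableD_fin.
have : \int[P]_x (L t.+1 x ^+ 2) <= \int[P]_x (L t x ^+ 2 + 2 * (L t x * xi t x) +
    (2 * Bt * L t x - 2 * r * N t x ^+ 3) + (L t.+1 x - L t x) ^+ 2).
  apply: le_Rintegral => //; first exact: integrableD_fin.
  move=> x _; rewrite -subr_ge0.
  (* The two sides differ only by the replacement of eps L S by the smaller r N^3. *)
  rewrite (_ : _ - _ = 2 * (eps * (L t x * S t x) - r * N t x ^+ 3)).
    by rewrite mulr_ge0// subr_ge0.
  by rewrite /xi; ring.
rewrite (RintegralD measurableT int3 intD2) (RintegralD measurableT int1 int2).
rewrite RintegralD//; last exact: integrableZl_fin.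
rewrite RintegralB//; [|exact: integrableZl_fin|exact: integrableZl_fin].
rewrite (RintegralZl 2 measurableT intLxi) (RintegralZl (2 * Bt) measurableT (intL t)).
rewrite (RintegralZl (2 * r) measurableT (intN3 t)).
have := dc t; move: Em ELxi; rewrite /m.
move: (\int[P]_x L t x) (\int[P]_x (N t x ^+ 3)) => u v.
lra.
Qed.

(** * Time-averaged moments and sublinear growth of the coordinates *)

Lemma sum_Rintegral_qnorm3_le : exists2 b, 0 < b & forall M,
  \sum_(t < M) \int[P]_x (qnorm w (fun k => Q t k x) ^+ 3) <= b * M%:R.
Proof.
have [r [c [r0 c0 rc]]] := energy_drift.
have EL0 t : 0 <= \int[P]_x (L t x ^+ 2) by apply: Rintegral_ge0 => x _; exact: sqr_ge0.
exists ((\int[P]_x (L 0 x ^+ 2) + c) / r + 1).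
  by rewrite ltr_wpDl// divr_ge0 ?(ltW r0)// addr_ge0.
move=> M.
have tele : \int[P]_x (L M x ^+ 2) + r * \sum_(t < M) \int[P]_x (N t x ^+ 3) <=
    \int[P]_x (L 0 x ^+ 2) + c * M%:R.
  elim: M => [|M IH]; first by rewrite big_ord0 !mulr0 !addr0.
  by rewrite big_ord_recr/= -[M.+1%:R]natr1; have := rc M; lra.
(* For positive [M] the initial energy is absorbed into the term linear in [M]. *)
case: M tele => [|M] tele; first by rewrite big_ord0 mulr0.
have M1 : 1 <= M.+1%:R :> R by rewrite ler1n.
have := EL0 M.+1; have := EL0 0.
rewrite mulrDl mul1r mulrAC => E0 EM.
apply: (@le_trans _ _ ((\int[P]_x (L 0 x ^+ 2) + c) * M.+1%:R / r)); last by rewrite lerDl.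
rewrite ler_pdivlMr// mulrC; have := tele; rewrite -[in X in X -> _]/N.
nra.
Qed.


(** Follows from the cubic bound through N^2 <= 1 + N^3. *)
Lemma sum_Rintegral_lyap_le : exists2 b, 0 < b & forall M,
  \sum_(t < M) \int[P]_x (lyap w (fun k => Q t k x)) <= b * M%:R.
Proof.
have [b b0 bM] := sum_Rintegral_qnorm3_le; exists (b + 1); first by rewrite addr_gt0.
move=> M; have E1 : \sum_(t < M) \int[P]_x (1 : R) = M%:R.
  by under eq_bigr do rewrite Rintegral_cstT; rewrite sumr_const card_ord.
rewrite mulrDl mul1r -[X in _ <= _ + X]E1.
apply: le_trans (lerD (bM M) (lexx _)); rewrite -big_split/=.
apply: ler_sum => t _; rewrite -RintegralD//; last 2 first.
- exact: intN3.
- exact: integrable_cst_fin.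
apply: le_Rintegral => //.
- exact: intL.
- by apply: integrableD_fin; [exact: intN3|exact: integrable_cst_fin].
move=> x _; rewrite -/(N t x) -/(L t x) -sqrN.
have [N1|N1] := leP (N t x) 1.
  by apply: (@le_trans _ _ 1); [exact: exprn_ile1|rewrite lerDr exprn_ge0].
apply: (@le_trans _ _ (N t x ^+ 3)); last by rewrite lerDl.
by rewrite [leRHS]exprSr ler_peMr ?exprn_ge0// ltW.
Qed.

Lemma integrable_qnorm3 t : int (fun x => qnorm w (fun k => Q t k x) ^+ 3).
Proof. exact: intN3. Qed.

Lemma integrable_Q2 t k : int (fun x => Q t k x ^+ 2).
Proof.
apply: le_integrable_fin (intS2 t); first exact: measurable_funX.
by move=> x; rewrite normrX lerXn2r ?nnegrE//; exact: (le_l1norm (Q t ^~ x)).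
Qed.

Lemma sum_Rintegral_Q2_le k : exists C, forall n,
  \sum_(t < n) \int[P]_x (Q t k x ^+ 2) * (t%:R ^+ 2)^-1 <= C.
Proof.
have [C C0 CL] := sqr_l1norm_le w_gt0.
have [b b0 bM] := sum_Rintegral_lyap_le.
exists (6 * (C * b)); apply: (@sum_div_sqr_bounded _ (fun t => \int[P]_x (Q t k x ^+ 2))).
  by move=> t; apply: Rintegral_ge0 => x _; exact: sqr_ge0.
move=> n; rewrite -[leRHS]mulrA; have := ler_wpM2l (ltW C0) (bM n); apply: le_trans.
rewrite mulr_sumr; apply: ler_sum => t _.
rewrite -(RintegralZl C measurableT (intL t)); apply: le_Rintegral => //.
- exact: integrable_Q2.
- exact: integrableZl_fin.
move=> x _; apply: le_trans (CL _).
by rewrite -real_normK ?num_real// lerXn2r ?nnegrE ?l1norm_ge0//; exact: (le_l1norm (Q t ^~ x)).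
Qed.

Lemma ae_Q_div_cvg0 k :
  {ae P, forall x, (fun t : nat => Q t k x / t%:R) @ \oo --> 0}.
Proof.
have [C QC] := sum_Rintegral_Q2_le k.
have intf t : int (fun x => (t%:R ^+ 2)^-1 * Q t k x ^+ 2).
  by apply: integrableZl_fin; exact: integrable_Q2.
have : {ae P, forall x, (fun t => (t%:R ^+ 2)^-1 * Q t k x ^+ 2) @ \oo --> 0}.
  apply: (@ae_cvg0_of_sum_bounded _ _ _ P _ C) => //.
    by move=> t x; rewrite mulr_ge0 ?sqr_ge0// invr_ge0 sqr_ge0.
  move=> n; apply: le_trans (QC n); apply: ler_sum => t _.
  by rewrite (RintegralZl _ measurableT (integrable_Q2 t k)) mulrC.
apply: filterS => x; under eq_fun do rewrite mulrC -expr_div_n.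
exact: cvg0_sqr.
Qed.

(** * The supermartingale and the pathwise average bound *)

Let X n x := \sum_(t < n) xi t x.
(** Only upward deviations of [X] matter, and its positive part is a nonnegative weight fit for the
    pull-out lemma. *)
Let Xp n x := Num.max (X n x) 0.

Let X_sqint n : square_integrable P (X n).
Proof. exact: square_integrable_sum. Qed.

Let Xp_ge0 n x : 0 <= Xp n x. Proof. by rewrite le_max lexx orbT. Qed.

Let Xp_sqint n : square_integrable P (Xp n).
Proof.
apply: square_integrable_le (X_sqint n).
  by apply: measurable_maxr => //; case: (X_sqint n).
move=> x; rewrite ger0_norm// /Xp maxEle; case: ifP => _ //; exact: ler_norm.
Qed.

(** The right side is the square of [Xp n x + xi n x]. The left side is 0 unless X(n+1) > 0, and
    then X(n+1) is at most the number squared on the right. *)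
Let XpS_le n x : Xp n.+1 x ^+ 2 <= Xp n x ^+ 2 + 2 * (Xp n x * xi n x) + xi n x ^+ 2.
Proof.
have -> : Xp n x ^+ 2 + 2 * (Xp n x * xi n x) + xi n x ^+ 2 = (Xp n x + xi n x) ^+ 2 by ring.
rewrite /Xp /X big_ord_recr/= -/(X n x).
have [_|X0] := leP (X n x + xi n x) 0; first by rewrite expr0n sqr_ge0.
have XX : X n x + xi n x <= Num.max (X n x) 0 + xi n x by rewrite lerD2r le_max lexx.
by rewrite lerXn2r ?nnegrE ?(ltW X0)// (le_trans (ltW X0)).
Qed.

(** The strict inequality is forced by Q(t+1), which enters [xi t]. *)
Let xi_adapted t n : (t < n)%N ->
  measurable_fun [set: gen_sigmaType (history n)] (xi t : gen_sigmaType (history n) -> R).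
Proof.
move=> tn; apply: measurable_funB; first apply: measurable_funB.
- by apply: measurable_lyap => k; exact: mQ_history.
- by apply: measurable_lyap => k; apply: mQ_history; exact: ltnW.
- apply: measurable_funB => //; apply: measurable_funM => //.
  by apply: measurable_l1norm => k; apply: mQ_history; exact: ltnW.
Qed.

(** Pointwise xi^2 <= 2 (L(t+1) - L)^2 + 4 Bt^2 + 4 eps^2 S^2; the means of the first and last terms
    are controlled by E[L], whose sums grow linearly. *)
Let sum_xi_sqr_le : exists C, forall n, \sum_(t < n) \int[P]_x (xi t x ^+ 2) <= C * n%:R.
Proof.
have [C C0 CL] := sqr_l1norm_le w_gt0.
have [c c0 cL] := drift_sqr_le.
have [b b0 bM] := sum_Rintegral_lyap_le.
pose a1 := 2 * c + 4 * Bt ^+ 2; pose a2 := 2 * c + 4 * eps ^+ 2 * C.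
have a20 : 0 <= a2.
  by rewrite addr_ge0 ?mulr_ge0 ?sqr_ge0// ltW.
exists (a1 + a2 * b) => n.
apply: (@le_trans _ _ (\sum_(t < n) (a1 + a2 * \int[P]_x L t x))); last first.
  rewrite big_split/= sumr_const card_ord -[a1 *+ n]mulr_natr [leRHS]mulrDl lerD2l.
  by rewrite -mulr_sumr -[leRHS]mulrA ler_wpM2l//; exact: bM.
apply: ler_sum => t _.
have intD2 : int (fun x => (L t.+1 x - L t x) ^+ 2).
  by have [] := square_integrableB (L_sqint t.+1) (L_sqint t).
have int1 : int (fun x => 2 * (L t.+1 x - L t x) ^+ 2) by exact: integrableZl_fin.
have int2 : int (fun x => 4 * eps ^+ 2 * C * L t x) by exact: integrableZl_fin.
have int3 : int (fun x => 4 * Bt ^+ 2 + 4 * eps ^+ 2 * C * L t x).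
  by apply: integrableD_fin => //; exact: integrable_cst_fin.
apply: (@le_trans _ _ (\int[P]_x (2 * (L t.+1 x - L t x) ^+ 2 +
    (4 * Bt ^+ 2 + 4 * eps ^+ 2 * C * L t x)))).
  apply: le_Rintegral => //; first exact: integrableD_fin.
  move=> x _; have SL : eps ^+ 2 * S t x ^+ 2 <= eps ^+ 2 * (C * L t x).
    by rewrite ler_wpM2l ?sqr_ge0//; exact: CL.
  have h1 := sqr_ge0 (L t.+1 x - L t x + (Bt - eps * S t x)).
  have h2 := sqr_ge0 (Bt + eps * S t x).
  move: SL h1 h2; rewrite /xi; move: (L t.+1 x) (L t x) (S t x) => l' l s.
  by rewrite !expr2; lra.
rewrite (RintegralD measurableT int1 int3) (RintegralZl 2 measurableT intD2).
rewrite RintegralD//; last exact: integrable_cst_fin.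
rewrite Rintegral_cstT (RintegralZl _ measurableT (intL t)).
by have := cL t; rewrite /a1 /a2; lra.
Qed.

(** The cross term has nonpositive mean, so each step adds at most the second moment of [xi]. *)
Let Xp_sqr_le : exists C, forall n, \int[P]_x (Xp n x ^+ 2) <= C * n%:R.
Proof.
have [C Cn] := sum_xi_sqr_le; exists C => n; apply: le_trans (Cn n).
elim: n => [|n IH].
  rewrite big_ord0 (_ : \int[P]_x _ = 0)//.
  under eq_Rintegral do rewrite /Xp /X big_ord0 maxxx expr0n.
  exact: Rintegral_cstT.
rewrite big_ord_recr/=; apply: le_trans (lerD IH (lexx _)).
have intXxi : int (fun x => Xp n x * xi n x) by exact: square_integrableM.
have EXxi : \int[P]_x (Xp n x * xi n x) <= 0.
  apply: (Rintegral_pull_out_le0 (@history_measurable n)) => //.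
  - exact: xi_le0.
  - apply: gen_sigma_ge; apply: measurable_maxr => //.
    by apply: measurable_sum => t; exact: xi_adapted.
have [_ intXp2] := Xp_sqint n; have [_ intXpS2] := Xp_sqint n.+1.
have int1 : int (fun x => Xp n x ^+ 2 + 2 * (Xp n x * xi n x)).
  by apply: integrableD_fin => //; exact: integrableZl_fin.
have : \int[P]_x (Xp n.+1 x ^+ 2) <=
    \int[P]_x (Xp n x ^+ 2 + 2 * (Xp n x * xi n x) + xi n x ^+ 2).
  by apply: le_Rintegral => //; exact: integrableD_fin.
rewrite (RintegralD measurableT int1 (intxi2 n)) RintegralD//; last exact: integrableZl_fin.
by rewrite (RintegralZl 2 measurableT intXxi); lra.
Qed.

Lemma ae_limn_esup_average_le : {ae P, forall x,
  (limn_esup (fun t : nat =>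
     ((t%:R)^-1 * \sum_(tau < t) \sum_(k < K) `|Q tau k x|)%:E) <= (Bt / eps)%:E)%E}.
Proof.
have [C XC] := Xp_sqr_le.
have int_f j : int (fun x => ((j ^ 2)%:R ^+ 2)^-1 * Xp (j ^ 2)%N x ^+ 2).
  by apply: integrableZl_fin; case: (Xp_sqint (j ^ 2)%N).
have : {ae P, forall x,
    (fun j => ((j ^ 2)%:R ^+ 2)^-1 * Xp (j ^ 2)%N x ^+ 2) @ \oo --> 0}.
  apply: (@ae_cvg0_of_sum_bounded _ _ _ P _ (6 * `|C|)) => //.
    by move=> j x; rewrite mulr_ge0 ?sqr_ge0// invr_ge0 sqr_ge0.
  move=> n.
  (* At time j^2 the second moment over j^4 is at most |C|/j^2; the sum of these is bounded by the
     Abel estimate for a constant sequence. Both sides vanish at j = 0. *)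
  apply: le_trans (@sum_div_sqr_bounded _ (fun=> `|C|) `|C| _ _ n) => //; last first.
    by move=> k; rewrite sumr_const card_ord mulr_natr.
  apply: ler_sum => j _; have [_ intX2] := Xp_sqint (j ^ 2)%N.
  rewrite (RintegralZl _ measurableT intX2).
  have [->|j0] := eqVneq (j : nat) 0%N.
    by rewrite exp0n// expr0n/= !invr0 mul0r mulr0.
  have j1 : 0 < (j ^ 2)%:R :> R by rewrite ltr0n expn_gt0 lt0n j0.
  rewrite [leLHS]mulrC -[j%:R ^+ 2]natrX ler_pdivrMr ?exprn_gt0//.
  rewrite [_ ^+ 2]expr2 -mulrA mulKf ?gt_eqF//.
  by apply: le_trans (XC _) _; rewrite ler_wpM2r// ler_norm.
apply: filterS => x; under eq_fun do rewrite mulrC -expr_div_n; move=> /cvg0_sqr.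
apply: (@limn_esup_average_squares _ (fun t => S t x) (fun n => Xp n x) (L 0 x)) => //.
(* The definition of [xi] telescopes to this identity; then L(n) >= 0 is dropped and [X] replaced by
   its positive part. *)
move=> n; have -> : eps * \sum_(t < n) S t x = Bt * n%:R + L 0 x + X n x - L n x.
  elim: n => [|n IH]; first by rewrite /X !big_ord0; ring.
  by rewrite /X !big_ord_recr/= mulrDr IH -[n.+1%:R]natr1 /X /xi; ring.
apply: (@le_trans _ _ (Bt * n%:R + L 0 x + X n x)); first by rewrite gerBl.
by rewrite lerD2l le_max lexx.
Qed.

(** * Negative drift of the norm away from the origin *)

Lemma qnorm_drift : exists c a : R, [/\ 0 < c, 0 < a &
  forall t (Y : T -> R),
    cond_exp_version P (gen_sigma (present t)) (fun x => qnorm w (fun k => Q t.+1 k x)) Y ->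
    {ae P, forall x, a <= qnorm w (fun k => Q t k x) ->
                     Y x <= qnorm w (fun k => Q t k x) - c}].
Proof.
have W1 := wbound_ge1 w_gt0; set W := wbound w in W1.
have W0 : 0 < W by lra.
pose r := eps / W; have r0 : 0 < r by exact: divr_gt0.
(* From N <= W S, (Bt - eps S)/(2N) <= Bt/(2N) - r/2; for N >= 2 Bt/r the first term is at most r/4,
   which leaves a drift of -r/4. *)
exists (r / 4), (2 * Bt / r); split; [exact: divr_gt0|by rewrite divr_gt0// mulr_gt0|].
set a := 2 * Bt / r; have a0 : 0 < a by rewrite divr_gt0// mulr_gt0.
have ar : a * r = 2 * Bt by rewrite divfK// gt_eqF.
clearbody a.
move=> t Y YX; have [intN' YG intY NY] := YX.
(* [A] is the event where the claim fails. It belongs to the sigma-algebra of Q(t), and is shown to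
   be null. *)
pose A := [set x | a <= N t x] `&` [set x | 0 < Y x - N t x + r / 4].
have mNp : measurable_fun [set: gen_sigmaType (present t)]
    (N t : gen_sigmaType (present t) -> R).
  by apply: measurable_qnorm => k; exact: mQ_present.
have mYp : measurable_fun [set: gen_sigmaType (present t)]
    (Y : gen_sigmaType (present t) -> R).
  by move=> _ B mB; rewrite setTI; exact: YG.
have GA : gen_sigma (present t) A.
  apply: (@measurableI _ (gen_sigmaType (present t))); first exact: gen_sigma_ge.
  have -> : [set x | 0 < Y x - N t x + r / 4] =
      (fun x => Y x - N t x + r / 4) @^-1` `]0, +oo[.
    by apply/seteqP; split => x /=; rewrite in_itv/= andbT.
  have : measurable_fun [set: gen_sigmaType (present t)]
      ((fun x => Y x - N t x + r / 4) : gen_sigmaType (present t) -> R).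
    by apply: measurable_funD => //; exact: measurable_funB.
  by move=> /(_ measurableT _ (measurable_itv `]0, +oo[)); rewrite setTI.
have mA := present_measurable GA.
(* the inverse of 2 N on A, as a power, whose measurability is known *)
pose Z x := \1_A x * (2 * N t x) `^ (- 1).
have ZE x : A x -> Z x = (2 * N t x)^-1.
  by move=> Ax; rewrite /Z indicE mem_set// mul1r powR_inv1// mulr_ge0.
have intN t' : int (N t').
  apply: (@le_integrable_fin _ _ _ _ _ (fun x => 1 + L t' x)) => //.
    move=> x; rewrite ger0_norm// -sqrN.
    by have := sqr_ge0 (N t' x - 2^-1); rewrite !expr2; lra.
  by apply: integrableD_fin => //; exact: integrable_cst_fin.
have intZxi : int (fun x => Z x * xi t x).
  apply: (@le_integrable_fin _ _ _ _ _ (fun x => (2 * a)^-1 * `|xi t x|)).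
  + apply: measurable_funM; last by case: (xi_sqint t).
    apply: measurable_funM; first exact: measurable_indic.
    by apply: (measurableT_comp (measurable_powR (-1))); exact: measurable_funM.
  + move=> x; rewrite normrM ler_wpM2r//.
    have [Ax|nAx] := pselect (A x); last first.
      by rewrite /Z indicE memNset// mul0r normr0 invr_ge0 mulr_ge0// ltW.
    have aN : a <= N t x by case: Ax.
    have N0 : 0 < N t x by exact: lt_le_trans aN.
    rewrite ZE// ger0_norm ?invr_ge0 ?mulr_ge0//.
    by rewrite lef_pV2 ?posrE ?mulr_gt0// ler_pM2l.
  + by apply: integrableZl_fin; exact: integrable_norm.
have Zxi0 : \int[P]_x (Z x * xi t x) <= 0.
  apply: (Rintegral_pull_out_le0 (@present_measurable t)) => //.
  - by move=> B GB; apply: xi_le0; exact: present_history.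
  - apply: gen_sigma_ge; apply: measurable_funM.
      exact: (@measurable_indic _ (gen_sigmaType (present t))).
    apply: (measurableT_comp (measurable_powR (-1))).
    exact: measurable_funM.
  - by move=> x; rewrite mulr_ge0// powR_ge0.
have int_h : int (fun x => Y x - N t x + r / 4).
  by apply: integrableD_fin; [exact: integrableB_fin|exact: integrable_cst_fin].
have intA (f : T -> R) : int f -> P.-integrable A (EFin \o f).
  by move=> intf; exact: integrableS intf.
have : \int[P]_(x in A) (Y x - N t x + r / 4) <= 0.
  (* On [A] the version [Y] integrates like N(t+1), for which a pointwise bound by [Z] times [xi] is
     available. *)
  have -> : \int[P]_(x in A) (Y x - N t x + r / 4) =
      \int[P]_(x in A) (N t.+1 x - N t x + r / 4).
    have intr : P.-integrable A (EFin \o (fun=> r / 4)).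
      exact/intA/integrable_cst_fin.
    rewrite (RintegralD mA (intA _ (integrableB_fin intY (intN t))) intr).
    rewrite (RintegralD mA (intA _ (integrableB_fin (intN t.+1) (intN t))) intr).
    rewrite (RintegralB mA (intA _ intY) (intA _ (intN t))).
    rewrite (RintegralB mA (intA _ (intN t.+1)) (intA _ (intN t))).
    by congr (_ - _ + _); rewrite /Rintegral -NY.
  have intNr : int (fun x => N t.+1 x - N t x + r / 4).
    by apply: integrableD_fin; [exact: integrableB_fin|exact: integrable_cst_fin].
  apply: le_trans Zxi0; rewrite Rintegral_indicM//; apply: le_Rintegral => //.
    exact: integrable_indicM.
  move=> x _; have [Ax|nAx] := pselect (A x); last first.
    by rewrite /Z !indicE memNset// !mul0r.
  have aN : a <= N t x by case: Ax.
  have N0 : 0 < N t x by exact: lt_le_trans aN.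
  rewrite ZE// indicE mem_set// mul1r ler_pdivlMl ?mulr_gt0//.
  have NS : r * N t x <= eps * S t x.
    rewrite /r mulrAC ler_pdivrMr// -[leRHS]mulrA ler_pM2l// [leRHS]mulrC.
    exact: (qnorm_le w_gt0 (Q t ^~ x)).
  have raN := ler_wpM2r (ltW r0) aN.
  (* Concavity of the square root, cleared of its denominator: 2N (N(t+1) - N) <= L(t+1) - L. *)
  have NN := sqr_ge0 (N t.+1 x - N t x).
  rewrite /xi -!sqrN; move: NS raN NN ar.
  move: (N t.+1 x) (N t x) (S t x) (r) => n' n s r'; rewrite !expr2; lra.
move=> /(Rintegral_gt0_negligible mA int_h (fun x => @proj2 _ _)).
apply: filterS => x nAx aN; rewrite leNgt; apply/negP => YN; apply: nAx; split => //=.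
by rewrite -/(N t x) in YN *; lra.
Qed.

End drift.

(** * Assembly, with passage to extended-real integrals *)

Theorem theorem7 (d : measure_display) (T : measurableType d) (R : realType)
  (P : probability T R) (K : nat)
  (Q : nat -> 'I_K -> T -> R) (p : nat -> T -> R)
  (w : 'I_K -> R) (D eps Bt : R) :
  (forall t k, measurable_fun [set: T] (Q t k)) ->
  (forall t, measurable_fun [set: T] (p t)) ->
  (forall k, 0 < w k) ->
  (* E[d_k(t)^4 | Q(t)] <= D *)
  (forall t k, exists Y : T -> R,
     cond_exp_version P (gen_sigma [set Q t j | j in [set: 'I_K]])
       (fun x => (Q t.+1 k x - Q t k x) ^+ 4) Y /\
     {ae P, forall x, Y x <= D}) ->
  (* E[||Q(0)||^4] < oo *)
  (\int[P]_x ((qnorm w (fun k => Q 0%N k x)) ^+ 4)%:E < +oo)%E ->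
  0 < eps -> 0 < Bt ->
  (* Delta(H(t)) <= Bt - eps * sum_k |Q_k(t)| *)
  (forall t, exists Y : T -> R,
     cond_exp_version P
       (gen_sigma ([set Q s j | s in [set s | (s <= t)%N] & j in [set: 'I_K]]
                   `|` [set p s | s in [set s | (s < t)%N]]))
       (fun x => lyap w (fun k => Q t.+1 k x) - lyap w (fun k => Q t k x)) Y /\
     {ae P, forall x, Y x <= Bt - eps * \sum_(k < K) `|Q t k x|}) ->
  (* (a) *)
  (exists c a : R, [/\ 0 < c, 0 < a &
     forall t (Y : T -> R),
       cond_exp_version P (gen_sigma [set Q t j | j in [set: 'I_K]])
         (fun x => qnorm w (fun k => Q t.+1 k x)) Y ->
       {ae P, forall x, a <= qnorm w (fun k => Q t k x) ->
                        Y x <= qnorm w (fun k => Q t k x) - c}]) /\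
  (* (b) *)
  (exists b : R, 0 < b /\ forall M : nat, (0 < M)%N ->
     ((M%:R^-1)%:E * \sum_(t < M) \int[P]_x ((qnorm w (fun k => Q t k x)) ^+ 3)%:E
        <= b%:E)%E) /\
  (* (c) *)
  (forall k : 'I_K,
     (\sum_(1 <= t <oo) ((\int[P]_x ((Q t k x) ^+ 2)%:E) * ((t%:R ^+ 2)^-1)%:E)
        < +oo)%E) /\
  (* (d) *)
  (forall k : 'I_K, {ae P, forall x, (fun t : nat => Q t k x / t%:R) @ \oo --> 0}) /\
  (* (e) *)
  {ae P, forall x,
     (limn_esup (fun t : nat =>
        ((t%:R)^-1 * \sum_(tau < t) \sum_(k < K) `|Q tau k x|)%:E)
      <= (Bt / eps)%:E)%E}.
Proof.
move=> mQ mp w_gt0 jump_moment init_moment eps_gt0 Bt_gt0 lyap_drift.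
split; first exact: (qnorm_drift mQ mp w_gt0 jump_moment init_moment eps_gt0 Bt_gt0 lyap_drift).
split.
  have [b b0 bM] :=
    sum_Rintegral_qnorm3_le mQ mp w_gt0 jump_moment init_moment eps_gt0 Bt_gt0 lyap_drift.
  exists b; split => // M M0.
  under eq_bigr do rewrite Rintegral_fin ?(integrable_qnorm3 mQ w_gt0 jump_moment init_moment)//.
  by rewrite sumEFin -EFinM lee_fin mulrC ler_pdivrMr ?ltr0n.
split.
  move=> k.
  have [C CM] :=
    sum_Rintegral_Q2_le mQ mp w_gt0 jump_moment init_moment eps_gt0 Bt_gt0 lyap_drift k.
  have intQ2 t := integrable_Q2 mQ w_gt0 jump_moment init_moment t k.
  apply: (@le_lt_trans _ _ C%:E); last exact: ltry.
  apply: lime_le.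
    apply: is_cvg_nneseries => t _ _; apply: mule_ge0.
      by apply: integral_ge0 => x _; rewrite lee_fin; exact: sqr_ge0.
    by rewrite lee_fin invr_ge0; exact: sqr_ge0.
  apply: nearW => n.
  under eq_bigr do rewrite Rintegral_fin// -EFinM.
  rewrite sumEFin lee_fin; apply: le_trans (CM n).
  (* The series starts at t = 1 and the bounded sum at t = 0, where the term is 0. *)
  case: n => [|n]; first by rewrite big_nil big_ord0.
  rewrite -[leRHS](big_mkord xpredT (fun t => \int[P]_x (Q t k x ^+ 2) * (t%:R ^+ 2)^-1)).
  by rewrite [leRHS]big_nat_recl// big_add1/= lerDr expr0n/= invr0 mulr0.
split.
  move=> k.
  exact: (ae_Q_div_cvg0 mQ mp w_gt0 jump_moment init_moment eps_gt0 Bt_gt0 lyap_drift).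
exact: (ae_limn_esup_average_le mQ mp w_gt0 jump_moment init_moment eps_gt0 Bt_gt0 lyap_drift).
Qed.
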